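(* Let $X$ be a real Banach space of dimension greater than one and let $T:X\rightrightarrows X^*$ be a (non-empty) monotone operator whose domain $D(T)$ is not a singleton and such that ${}^{ic}D(T)\neq\emptyset$. Then $T$ is maximal monotone if and only if both of the following hold: (i) $T+N_P$ is maximal monotone for every plane (two-dimensional affine subset) $P\subset X$ such that $P\cap{}^{ic}D(T)\neq\emptyset$; (ii) for every $x\in D(T)$ the set $T(x)$ is weak-star closed and convex.
   Context: $X^*$ is the topological dual of $X$ and $\langle x,x^*\rangle:=x^*(x)$. A multifunction $T:X\rightrightarrows X^*$ is identified with its graph $\{(x,x^* )\mid x^*\in T(x)\}$; its domain is $D(T)=\{x\mid T(x)\neq\emptyset\}$. $T$ is monotone if $\langle x_1-x_2,x_1^*-x_2^*\rangle\ge0$ for all $(x_1,x_1^* ),(x_2,x_2^* )\in T$; it is maximal monotone if it is monotone and its graph is not properly contained in the graph of another monotone operator $X\rightrightarrows X^*$. Sums of operators are pointwise: $(S+T)(x)=S(x)+T(x)$ (empty if one of the two is empty). For $C\subset X$, $N_C(x)=\{x^*\in X^*\mid\langle y-x,x^*\rangle\le0\ \forall y\in C\}$ if $x\in C$, and $N_C(x)=\emptyset$ otherwise. For $S\subset X$, the relative algebraic interior ${}^{i}S$ is the set of $s\in S$ such that for every $u\in\operatorname{aff}S$ (affine hull) there is $\rho>0$ with $(1-\lambda)s+\lambda u\in S$ for all $\lambda\in[0,\rho]$; ${}^{ic}S:={}^{i}S$ if $\operatorname{aff}S$ is norm closed, and ${}^{ic}S:=\emptyset$ otherwise. *)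

(* Defs.v *)
From HB Require Import structures.
From mathcomp Require Import all_boot all_order all_algebra.
From mathcomp Require Import all_classical all_reals all_analysis.

Set Implicit Arguments.
Unset Strict Implicit.
Unset Printing Implicit Defensive.

Import Order.TTheory GRing.Theory Num.Theory.
Import numFieldNormedType.Exports.

Local Open Scope classical_set_scope.
Local Open Scope ring_scope.

(* Topological dual, as the submodule of continuous linear functionals of the
   function space X -> R^o. *)
Section Dual.
Context {R : realType} (X : normedModType R).

Definition dual_pred : {pred X -> R^o} :=
  fun f => `[< linear f /\ continuous f >].

Record dual : Type := Dual {
  dual_fun :> X -> R^o;
  dual_funP : dual_fun \in dual_pred }.

HB.instance Definition _ := [isSub for dual_fun].
HB.instance Definition _ := [Choice of dual by <:].

Fact dual_submod_closed : submod_closed dual_pred.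
Proof.
split.
  apply/asboolP; split=> [a u v|x]; last exact: cst_continuous.
  by rewrite -[RHS]/(a *: 0 + 0 : R^o) scaler0 addr0.
move=> k f g /asboolP[lf cf] /asboolP[lg cg]; apply/asboolP; split=> [a u v|x].
  rewrite -[LHS]/(k *: f (a *: u + v) + g (a *: u + v)).
  rewrite -[RHS]/(a *: (k *: f u + g u) + (k *: f v + g v)).
  by rewrite lf lg !scalerDr !scalerA mulrC addrACA.
by apply: continuousD; [apply: continuousZl_tmp; exact: cf | exact: cg].
Qed.

HB.instance Definition _ :=
  GRing.isSubmodClosed.Build R (X -> R^o) dual_pred dual_submod_closed.
HB.instance Definition _ := [SubChoice_isSubLmodule of dual by <:].

Definition weak_star : topologicalType :=
  initial_topology (dual_fun : dual -> {ptws X -> R^o}).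

End Dual.

Section LinearGeometry.
Context {R : realType} {X : normedModType R}.
Implicit Types (x y u v p : X) (S A P : set X).

Definition lin_indep2 u v :=
  forall a b : R, a *: u + b *: v = 0 -> a = 0 /\ b = 0.

Definition plane P := exists p u v, lin_indep2 u v /\
  P = [set x | exists a b : R, x = p + a *: u + b *: v].

Definition affine_set A :=
  forall x y (t : R), A x -> A y -> A ((1 - t) *: x + t *: y).

Definition aff S : set X := smallest affine_set S.

Definition rel_alg_int S : set X :=
  [set s | S s /\ forall u, aff S u -> exists2 rho : R, 0 < rho &
    forall l : R, 0 <= l <= rho -> S ((1 - l) *: s + l *: u)].

(* Empty unless [aff S] is norm closed. *)
Definition ic S : set X := [set s | closed (aff S) /\ rel_alg_int S s].

End LinearGeometry.

Definition dim_gt1 {R : realType} (X : normedModType R) :=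
  exists u v : X, lin_indep2 u v.

Section Operators.
Context {R : realType} {X : normedModType R}.
Implicit Types (S T : X -> set (dual X)) (C : set X).

Definition op_graph T : set (X * dual X) := [set z | T z.1 z.2].

Definition op_dom T : set X := [set x | T x !=set0].

Definition monotone_op T := forall x1 x2 (f1 f2 : dual X),
  T x1 f1 -> T x2 f2 -> 0 <= (f1 - f2) (x1 - x2).

Definition maximal_monotone T := monotone_op T /\
  ~ exists S, monotone_op S /\ op_graph T `<` op_graph S.

Definition op_add S T : X -> set (dual X) :=
  fun x => [set f + g | f in S x & g in T x].

Definition normal_cone C : X -> set (dual X) :=
  fun x => [set f | C x /\ forall y, C y -> f (y - x) <= 0].

End Operators.

(* Main.v *)
(* If T is maximal and (z, z') is monotonically related to T + N_P, one has to
   find f in T(z) agreeing with z' on the direction of P. Let H be the convex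
   hull of the triples (y, y', <y, y'>) with (y, y') in T. By the Mazur-Orlicz
   form of the Hahn-Banach theorem, a functional f of norm at most K such that
   (z, f) is related to T and f = z' on the part of P in aff D(T) exists as soon
   as s - <z, q> >= <p - z, z'> - K |y - p| for all (y, q, s) in H and such p.
   Every point c of ic D(T) is a "bounded point": the functions
   (y, q, s) |-> (<c + w, q> - s) / (1 + |y|) on H are bounded above uniformly
   in small w parallel to aff D(T), by the uniform boundedness principle.
   Bounded points form a relatively open set contained in D(T), and the segment
   from a bounded point to a point of D(T) consists of bounded points, its end
   excepted. Following such segments from bounded points x of P to z yields
   elements f of T(z) with <x - z, f - z'> >= 0, and choosing
   x = (p + k c) / (1 + k) with k proportional to |y - p| gives the required
   inequality.

   Conversely, if (z, z') is related to T, the planes through c, z and z + u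
   provide, for each u, some f in T(z) with f(u) = z'(u); hence z' is in T(z) by
   separation. *)
Require Import Defs.
From mathcomp Require Import all_boot all_order all_algebra.
From mathcomp Require Import all_classical all_reals all_analysis.
From mathcomp Require Import ring lra.

Set Implicit Arguments.
Unset Strict Implicit.
Unset Printing Implicit Defensive.

Import Order.TTheory GRing.Theory Num.Theory.
Import numFieldNormedType.Exports.

Local Open Scope classical_set_scope.
Local Open Scope ring_scope.

(** * Sublinear functionals and the Mazur-Orlicz theorem *)

Section HahnBanach.
Context {R : realType} {E : lmodType R}.
Implicit Types (p q : E -> R) (C : E -> R -> Prop).

Definition sublinear q :=
  (forall x y, q (x + y) <= q x + q y) /\
  (forall (t : R) x, 0 <= t -> q (t *: x) <= t * q x).

Lemma sublinear0 q : sublinear q -> q 0 = 0.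
Proof.
move=> [qD qZ]; have := qD 0 0; have := qZ 0 0 (lexx _).
rewrite addr0 scale0r; lra.
Qed.

Lemma sublinearN q x : sublinear q -> - q (- x) <= q x.
Proof.
move=> sq; have [qD _] := sq; have := qD x (- x).
by rewrite subrr (sublinear0 sq); lra.
Qed.

(** Common pattern of the three infima below: over a chain, over the shifts in
    [sublinear_minimal_linear], and over the constraints in [mazur_orlicz]. *)
Lemma sublinear_inf (S : E -> set R) :
  (forall x, S x !=set0) -> (forall x, has_lbound (S x)) ->
  (forall x y a b, S x a -> S y b -> exists2 c, S (x + y) c & c <= a + b) ->
  (forall (t : R) x a, 0 < t -> S x a -> exists2 c, S (t *: x) c & c <= t * a) ->
  (exists2 c, S 0 c & c <= 0) ->
  sublinear (fun x => inf (S x)).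
Proof.
move=> S0 Slb SD SZ [c0 Sc0 c00]; have Si x : has_inf (S x) by [].
have leS x a : S x a -> inf (S x) <= a by move=> Sa; apply: ge_inf.
split=> [x y|t x].
  apply/ler_addgt0Pr => e e0; have e2 : 0 < e / 2 by lra.
  have [a Sa la] := inf_adherent e2 (Si x).
  have [b Sb lb] := inf_adherent e2 (Si y).
  have [c Sc lc] := SD _ _ _ _ Sa Sb; have := leS _ _ Sc; lra.
rewrite le_eqVlt => /predU1P[<-|t0].
  by rewrite scale0r mul0r; apply: le_trans c00; exact: leS.
rewrite -ler_pdivrMl//; apply: lb_le_inf => // a Sa.
have [c Sc lc] := SZ _ _ _ t0 Sa.
by rewrite ler_pdivrMl//; apply: le_trans lc; exact: leS.
Qed.

(** Zorn's lemma for the reversed pointwise order: the infimum of a non-empty chain is again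
    sublinear, and it is finite because [- p (- x)] bounds the chain below. *)
Lemma sublinear_minimal p : sublinear p ->
  exists q, [/\ sublinear q, forall x, q x <= p x &
    forall q', sublinear q' -> (forall x, q' x <= q x) ->
      forall x, q x <= q' x].
Proof.
move=> sp; pose Q := {q | sublinear q /\ forall x, q x <= p x}.
pose r (q1 q2 : Q) := `[< forall x, sval q2 x <= sval q1 x >].
have pQ : sublinear p /\ forall x, p x <= p x by [].
have [||A totA|[q [sq qp]] qmin] := @ZL_preorder Q (exist _ p pQ) r.
- by move=> q; apply/asboolP.
- move=> q1 q2 q3 /asboolP h1 /asboolP h2; apply/asboolP => x.
  exact: le_trans (h2 x) (h1 x).
- have [[s0 As0]|/forallNP A0] := pselect (exists s, A s); last first.
    by exists (exist _ p pQ) => s /A0.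
  pose S x : set R := [set sval q x | q in A].
  have Slb x : has_lbound (S x).
    exists (- p (- x)) => _ [[s [ss sp']] _ <-] /=.
    by apply: le_trans (sublinearN _ ss); rewrite lerN2.
  have leS x s : A s -> inf (S x) <= sval s x.
    by move=> As; apply: ge_inf => //; exists s.
  have sS : sublinear (fun x => inf (S x)).
    apply: sublinear_inf => // [x|x y _ _ [s1 A1 <-] [s2 A2 <-]|t x _ t0 [s As <-]|].
    + by exists (sval s0 x); exists s0.
    + have [/asboolP le12|/asboolP le21] := totA _ _ A1 A2.
      * exists (sval s2 (x + y)); first by exists s2.
        have [[qD _] _] := svalP s2.
        by apply: le_trans (qD x y) _; rewrite lerD2r.
      * exists (sval s1 (x + y)); first by exists s1.
        have [[qD _] _] := svalP s1.
        by apply: le_trans (qD x y) _; rewrite lerD2l.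
    + exists (sval s (t *: x)); first by exists s.
      by have [[_ qZ] _] := svalP s; apply/qZ/ltW.
    + exists (sval s0 0); first by exists s0.
      by have [/sublinear0 -> _] := svalP s0.
  have iS : sublinear (fun x => inf (S x)) /\ forall x, inf (S x) <= p x.
    split=> // x; apply: le_trans (leS x _ As0) _.
    by have [_ ] := svalP s0; apply.
  exists (exist (fun s => sublinear s /\ forall x, s x <= p x) _ iS) => s As.
  by apply/asboolP => x /=; exact: leS.
exists q; split=> // q' sq' q'q.
have q'Q : sublinear q' /\ forall x, q' x <= p x.
  by split=> // x; exact: le_trans (q'q x) (qp x).
pose sq'Q : Q := exist (fun s => sublinear s /\ forall x, s x <= p x) q' q'Q.
by have /asboolP/= := qmin sq'Q (introT (asboolP _) q'q).
Qed.

Lemma sublinear_minimal_linear q : sublinear q ->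
  (forall q', sublinear q' -> (forall x, q' x <= q x) ->
    forall x, q x <= q' x) ->
  forall (t : R) x y, q (t *: x + y) = t * q x + q y.
Proof.
move=> sq qmin; have [qD qZ] := sq; have q0 := sublinear0 sq.
have qDge x v : q x + q v <= q (x + v).
  (* The infimum of [S x] is sublinear and at most [q x] (take [t = 0]), hence equal to [q x] by
     minimality; [t = 1] then gives superadditivity. *)
  pose S x : set R := [set q (x + t *: v) - t * q v | t in [set t | 0 <= t]].
  have Slb y : has_lbound (S y).
    exists (- q (- y)) => _ [t /= t0 <-].
    have := qD (- y) (y + t *: v); rewrite addKr.
    have [->|tN0] := eqVneq t 0.
      by rewrite !scale0r addr0 mul0r q0; lra.
    have {}t0 : 0 < t by rewrite lt0r tN0.
    have := qZ t^-1 (t *: v); rewrite invr_ge0 (ltW t0) => /(_ isT).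
    by rewrite scalerA mulVf// scale1r ler_pdivlMl//; lra.
  have sS : sublinear (fun x => inf (S x)).
    apply: sublinear_inf => //
      [y|y z _ _ [t /= t0 <-] [s /= s0 <-]|k y _ k0 [t /= t0 <-]|].
    - by exists (q (y + 0 *: v) - 0 * q v); exists 0 => /=.
    - exists (q (y + z + (t + s) *: v) - (t + s) * q v).
        by exists (t + s) => //=; exact: addr_ge0.
      by rewrite scalerDl addrACA; have := qD (y + t *: v) (z + s *: v); lra.
    - exists (q (k *: y + (k * t) *: v) - (k * t) * q v).
        by exists (k * t) => //=; rewrite mulr_ge0// ltW.
      by rewrite -scalerA -scalerDr; have := qZ k (y + t *: v) (ltW k0); lra.
    - by exists (q (0 + 0 *: v) - 0 * q v); [exists 0 => /=|rewrite scale0r addr0 q0; lra].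
  have Sq y : inf (S y) <= q y.
    by apply: ge_inf => //; exists 0 => //=; rewrite scale0r addr0 mul0r subr0.
  have := qmin _ sS Sq x.
  have : inf (S x) <= q (x + v) - q v.
    by apply: ge_inf => //; exists 1 => //=; rewrite scale1r mul1r.
  lra.
have qDE x v : q (x + v) = q x + q v by apply/eqP; rewrite eq_le qD qDge.
have qN x : q (- x) = - q x by have := qDE x (- x); rewrite subrr q0; lra.
have qZp t x : 0 <= t -> q (t *: x) = t * q x.
  move=> t0; apply/eqP; rewrite eq_le qZ//=.
  by have := qZ t (- x) t0; rewrite scalerN !qN; lra.
move=> t x y; rewrite qDE; congr (_ + _); have [t0|t0] := leP 0 t; first exact: qZp.
have Nt0 : 0 <= - t by lra.
by have := qZp (- t) x Nt0; rewrite scaleNr qN; lra.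
Qed.

(* Mazur-Orlicz: the Hahn-Banach theorem for the sublinear functional
   [x |-> inf {p (x - t a) + t b | (a, b) in C, t >= 0}]. *)
Theorem mazur_orlicz p C : sublinear p ->
  (exists a b, C a b) ->
  (forall (t : R) a b a' b', 0 <= t <= 1 -> C a b -> C a' b' ->
     C ((1 - t) *: a + t *: a') ((1 - t) * b + t * b')) ->
  (forall a b, C a b -> 0 <= p (- a) + b) ->
  exists f : E -> R, [/\ forall (t : R) x y, f (t *: x + y) = t * f x + f y,
    forall x, f x <= p x & forall a b, C a b -> f a <= b].
Proof.
move=> sp [a0 [b0 Cab0]] Ccvx Cp; have [pD pZ] := sp.
pose S x : set R := [set c | exists (t : R) a b,
  [/\ 0 <= t, C a b & c = p (x - t *: a) + t * b]].
(* Combine [p (- t a) <= p (- x) + p (x - t a)] with [p (- t a) + t b >= 0], a rescaling of [Cp]. *)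
have Slb x : has_lbound (S x).
  exists (- p (- x)) => _ [t [a [b [t0 Cab ->]]]].
  have := pD (- x) (x - t *: a); rewrite addKr.
  have [->|tN0] := eqVneq t 0.
    by rewrite !scale0r subr0 mul0r oppr0 (sublinear0 sp); lra.
  have {}t0 : 0 < t by rewrite lt0r tN0.
  have := pZ t^-1 (- (t *: a)); rewrite invr_ge0 (ltW t0) => /(_ isT).
  rewrite scalerN scalerA mulVf// scale1r ler_pdivlMl//.
  have := mulr_ge0 (ltW t0) (Cp _ _ Cab); lra.
have sS : sublinear (fun x => inf (S x)).
  apply: sublinear_inf => // [x|x y c c'|k x c k0|].
  - by exists (p (x - 0 *: a0) + 0 * b0); exists 0, a0, b0.
  - move=> [t [a [b [t0 Cab ->]]]] [t' [a' [b' [t'0 Cab' ->]]]].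
    have [tt0|tt0] := eqVneq (t + t') 0.
      have -> : t = 0 by lra.
      have -> : t' = 0 by lra.
      exists (p (x + y - 0 *: a0) + 0 * b0); first by exists 0, a0, b0.
      by rewrite !scale0r !subr0 !mul0r !addr0.
    have tt_gt0 : 0 < t + t' by rewrite lt_neqAle eq_sym tt0 addr_ge0.
    (* The weight for which [t + t'] times the convex combination of [(a, b)] and [(a', b')] is
       [t (a, b) + t' (a', b')]. *)
    pose s := t' / (t + t').
    have s01 : 0 <= s <= 1.
      rewrite ler_pdivrMr// mul1r lerDr t0 andbT.
      by rewrite divr_ge0// ltW.
    have ts' : (t + t') * s = t' by rewrite /s mulrC divfK.
    have ts : (t + t') * (1 - s) = t by rewrite mulrBr mulr1 ts'; lra.
    clearbody s.
    exists (p (x + y - (t + t') *: ((1 - s) *: a + s *: a')) +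
            (t + t') * ((1 - s) * b + s * b')).
      by exists (t + t'), ((1 - s) *: a + s *: a'), ((1 - s) * b + s * b');
        split; [exact: ltW|exact: Ccvx|].
    rewrite scalerDr mulrDr !scalerA !mulrA ts ts' opprD addrACA.
    by have := pD (x - t *: a) (y - t' *: a'); lra.
  - move=> [t [a [b [t0 Cab ->]]]].
    exists (p (k *: x - (k * t) *: a) + (k * t) * b).
      by exists (k * t), a, b; split=> //; rewrite mulr_ge0// ltW.
    by rewrite -scalerA -scalerBr; have := pZ k (x - t *: a) (ltW k0); lra.
  - exists (p (0 - 0 *: a0) + 0 * b0); first by exists 0, a0, b0.
    by rewrite scale0r subr0 (sublinear0 sp); lra.
have leS x t a b : 0 <= t -> C a b -> inf (S x) <= p (x - t *: a) + t * b.
  by move=> t0 Cab; apply: ge_inf => //; exists t, a, b.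
(* Minimality makes [f] linear; [t = 0] gives [f <= p], and [t = 1] at the point [a] gives
   [f a <= b]. *)
have [f [sf fS fmin]] := sublinear_minimal sS.
exists f; split=> [|x|a b Cab]; first exact: sublinear_minimal_linear.
- apply: le_trans (fS x) _; have := leS x 0 _ _ (lexx _) Cab0.
  by rewrite scale0r subr0 mul0r addr0.
- apply: le_trans (fS a) _; have := leS a 1 _ _ ler01 Cab.
  by rewrite scale1r subrr mul1r (sublinear0 sp) add0r.
Qed.

End HahnBanach.

(** * Continuous functionals and linear subspaces *)

Section DualElements.
Context {R : realType} {X : normedModType R}.
Implicit Types (f g : dual X) (x y v w : X) (V : set X).

Definition ev f x : R := f x.

Lemma ev_linear f (t : R) x y : ev f (t *: x + y) = t * ev f x + ev f y.
Proof. by have /asboolP[lf _] := dual_funP f; exact: lf. Qed.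

Lemma evD f x y : ev f (x + y) = ev f x + ev f y.
Proof. by rewrite -[x in LHS]scale1r ev_linear mul1r. Qed.

Lemma ev0 f : ev f 0 = 0.
Proof. by have := evD f 0 0; rewrite addr0; lra. Qed.

Lemma evZ f (t : R) x : ev f (t *: x) = t * ev f x.
Proof. by rewrite -[_ *: _]addr0 ev_linear ev0 addr0. Qed.

Lemma evN f x : ev f (- x) = - ev f x.
Proof. by rewrite -scaleN1r evZ mulN1r. Qed.

Lemma evB f x y : ev f (x - y) = ev f x - ev f y.
Proof. by rewrite evD evN. Qed.

Lemma evDl f g x : ev (f + g) x = ev f x + ev g x. Proof. by []. Qed.
Lemma evNl f x : ev (- f) x = - ev f x. Proof. by []. Qed.
Lemma evBl f g x : ev (f - g) x = ev f x - ev g x. Proof. by []. Qed.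
Lemma evZl (t : R) f x : ev (t *: f) x = t * ev f x. Proof. by []. Qed.
Lemma ev0l x : ev 0 x = 0. Proof. by []. Qed.

Definition evE := (evD, evN, evZ, ev0, evDl, evNl, evZl, ev0l).

Lemma dual_of_bounded (h : X -> R) (K : R) :
  (forall (t : R) x y, h (t *: x + y) = t * h x + h y) ->
  (forall x, `|h x| <= K * `|x|) ->
  exists f, forall x, ev f x = h x.
Proof.
move=> hlin hK; have K0 : 0 <= Num.max K 0 by rewrite le_max lexx orbT.
have hB x y : h y - h x = h (y - x).
  have h0 : h 0 = 0 by have := hlin 1 0 0; rewrite scale1r addr0; lra.
  have := hlin (-1) x y; rewrite scaleN1r addrC => ->; lra.
suff hP : (h : X -> R^o) \in @dual_pred R X by exists (Dual hP).
apply/asboolP; split; first exact: hlin.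
move=> x; apply/cvgrPdist_lt => e e0.
have d0 : 0 < e / (Num.max K 0 + 1) by rewrite divr_gt0//; lra.
apply/nbhs_normP; exists (e / (Num.max K 0 + 1)) => //= y /= xy.
rewrite hB; apply: le_lt_trans (hK _) _.
apply: (@le_lt_trans _ _ (Num.max K 0 * `|x - y|)).
  by rewrite ler_wpM2r// le_max lexx.
move: xy; rewrite ltr_pdivlMr; last lra.
apply: le_lt_trans; rewrite mulrC ler_wpM2l//; lra.
Qed.

Lemma ev_bounded f : exists2 K : R, 0 < K & forall x, `|ev f x| <= K * `|x|.
Proof.
have /asboolP[lf cf] := dual_funP f.
have /cvgrPdist_lt/(_ 1 ltr01)/nbhs_normP[d /= d0 fd] := cf 0.
exists (2 / d) => [|x]; first by rewrite divr_gt0.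
have [->|x0] := eqVneq x 0; first by rewrite ev0 !normr0 mulr0.
have nx0 : 0 < `|x| by rewrite normr_gt0.
have xN0 : `|x| != 0 by rewrite normr_eq0.
have d2 : d / 2 < d by lra.
have k0 : 0 < d / 2 / `|x| by rewrite !divr_gt0.
have := fd ((d / 2 / `|x|) *: x); rewrite /= sub0r normrN normrZ.
rewrite -/(ev f 0) -/(ev f _) ev0 sub0r normrN evZ.
rewrite (gtr0_norm k0) divfK// normrM (gtr0_norm k0) => /(_ d2) h.
rewrite mulrAC ler_pdivlMr// mulrC.
move: h; rewrite mulrAC ltr_pdivrMr// mul1r; lra.
Qed.

(** The sublinear functional is [K |x|]: domination by it makes the linear functional continuous and
    bounds its norm. *)
Theorem dual_mazur_orlicz (C : X -> R -> Prop) (K : R) : 0 <= K ->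
  (exists a b, C a b) ->
  (forall (t : R) a b a' b', 0 <= t <= 1 -> C a b -> C a' b' ->
     C ((1 - t) *: a + t *: a') ((1 - t) * b + t * b')) ->
  (forall a b, C a b -> 0 <= K * `|a| + b) ->
  exists f, (forall x, `|ev f x| <= K * `|x|) /\
            (forall a b, C a b -> ev f a <= b).
Proof.
move=> K0 C0 Ccvx CK.
have sK : sublinear (fun x : X => K * `|x|).
  split=> [x y|t x t0]; first by rewrite -mulrDr ler_wpM2l// ler_normD.
  by rewrite normrZ ger0_norm// mulrCA.
have [|h [hlin hK hC]] := mazur_orlicz sK C0 Ccvx.
  by move=> a b /CK; rewrite normrN.
have h0 : h 0 = 0 by have := hlin 1 0 0; rewrite scale1r addr0; lra.
have hN x : h (- x) = - h x.
  by have := hlin (-1) x 0; rewrite scaleN1r addr0 => ->; lra.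
have hKn x : `|h x| <= K * `|x|.
  by rewrite ler_norml hK andbT; have := hK (- x); rewrite hN normrN; lra.
have [f fh] := dual_of_bounded hlin hKn.
by exists f; split=> [x|a b]; rewrite fh; [exact: hKn|exact: hC].
Qed.

(** Obtained from the single constraint [f (x - y) <= - |x - y|]. It also turns vector identities
    into scalar ones, within reach of [ring] and [field]. *)
Lemma dual_separates x y : (forall f, ev f x = ev f y) -> x = y.
Proof.
move=> fxy; apply/eqP; rewrite -subr_eq0; apply/negPn/negP => d0.
have [||t a b a' b' _ [-> ->] [-> ->]|a b [-> ->]|f [_ fC]] :=
  @dual_mazur_orlicz (fun a b => a = x - y /\ b = - `|x - y|) 1.
- exact: ler01.
- by exists (x - y), (- `|x - y|).
- by rewrite -scalerDl subrK scale1r; split=> //; ring.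
- by rewrite mul1r subrr.
have := fC _ _ (conj erefl erefl); rewrite evB fxy subrr oppr_ge0.
by rewrite leNgt normr_gt0 d0.
Qed.

Definition linear_subspace V :=
  V 0 /\ forall (t : R) x y, V x -> V y -> V (t *: x + y).

Lemma linear_subspaceZ V (t : R) x : linear_subspace V -> V x -> V (t *: x).
Proof. by move=> [V0 VD] Vx; rewrite -[_ *: _]addr0; exact: VD. Qed.

Lemma linear_subspaceD V x y : linear_subspace V -> V x -> V y -> V (x + y).
Proof. by move=> [_ VD] Vx Vy; rewrite -[x]scale1r; exact: VD. Qed.

Lemma linear_subspaceN V x : linear_subspace V -> V x -> V (- x).
Proof. by move=> sV Vx; rewrite -scaleN1r; exact: linear_subspaceZ. Qed.

Lemma linear_subspaceB V x y : linear_subspace V -> V x -> V y -> V (x - y).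
Proof. by move=> sV Vx Vy; apply: linear_subspaceD => //; exact: linear_subspaceN. Qed.

End DualElements.

(** * The uniform boundedness principle on a closed subspace *)

Lemma closed_subspace_uniform_boundedness (R : realType)
    (X : completeNormedModType R) (V : set X) (F : set (dual X)) :
  closed V -> linear_subspace V ->
  (forall v, V v -> exists M : R, forall f, F f -> ev f v <= M) ->
  exists2 M : R, 0 < M & forall f v, F f -> V v -> ev f v <= M * `|v|.
Proof.
move=> cV sV Fpt; apply: contrapT => nF.
(* Without a uniform bound, every ball centred in [V] contains another one, of at most half the
   radius, on which some [f] in [F] exceeds [n]. The centres of such nested balls converge to a
   point of [V] at which [F] is unbounded. *)
have step (n : nat) (a : X) (r : R) : V a -> 0 < r -> exists b : X * R,
    [/\ V b.1, 0 < b.2, b.2 <= r / 2, `|b.1 - a| + b.2 <= r &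
    exists2 f, F f & forall y, `|y - b.1| <= b.2 -> n%:R < ev f y].
  move=> Va r0; apply: contrapT => nb; apply: nF.
  (* A value above [n] at [v] would persist on a small ball around [v]. This upper bound near [a]
     and the pointwise one at [- a] bound [F] near [0], hence uniformly. *)
  have Fle f v : F f -> V v -> `|v - a| < r -> ev f v <= n%:R.
    move=> Ff Vv va; rewrite leNgt; apply/negP => fv; apply: nb.
    have [L L0 fL] := ev_bounded f.
    pose s := Num.min (r / 2) (Num.min (r - `|v - a|) ((ev f v - n%:R) / (L * 2))).
    have s1 : s <= r / 2 by rewrite ge_min lexx.
    have s2 : s <= r - `|v - a| by rewrite !ge_min lexx orbT.
    have s3 : s <= (ev f v - n%:R) / (L * 2) by rewrite !ge_min lexx !orbT.
    have s0 : 0 < s by rewrite !lt_min divr_gt0//= divr_gt0 ?mulr_gt0//= ?subr_gt0// va.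
    exists (v, s); split=> //=; first lra.
    exists f => // y yv; have := fL (y - v).
    rewrite ler_norml evB => /andP[+ _].
    have : L * `|y - v| <= (ev f v - n%:R) / 2.
      rewrite -ler_pdivlMl// mulrC -mulrA -invfM [2 * L]mulrC.
      exact: le_trans yv s3.
    lra.
  have [M' FM'] := Fpt (- a) (linear_subspaceN sV Va).
  pose N := `|n%:R + M'| + 1.
  have N0 : 0 < N by rewrite /N; have := normr_ge0 (n%:R + M'); lra.
  exists (2 / r * N); first by rewrite mulr_gt0// divr_gt0.
  move=> f v Ff Vv; have [->|v0] := eqVneq v 0; first by rewrite ev0 normr0 mulr0.
  have nv0 : 0 < `|v| by rewrite normr_gt0.
  have vN0 : `|v| != 0 by rewrite normr_eq0.
  have r2 : r / 2 < r by lra.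
  pose k := r / 2 / `|v|; have k0 : 0 < k by rewrite !divr_gt0.
  have := Fle f (a + k *: v) Ff (linear_subspaceD sV Va (linear_subspaceZ _ sV Vv)).
  rewrite addrAC subrr add0r normrZ gtr0_norm// /k divfK// => /(_ r2).
  rewrite -/k !evE; have := FM' f Ff; rewrite evN => h1 h2.
  have : k * ev f v <= N by rewrite /N; have := ler_norm (n%:R + M'); lra.
  rewrite -ler_pdivlMl//; congr (_ <= _).
  by rewrite /k !invfM !invrK; ring.
(* The conditions on the ball become premises so that [choice] applies; when they fail, the old ball
   serves as a dummy value. *)
have step' (b : nat * (X * R)) : exists c : X * R, V b.2.1 -> 0 < b.2.2 ->
    [/\ V c.1, 0 < c.2, c.2 <= b.2.2 / 2, `|c.1 - b.2.1| + c.2 <= b.2.2 &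
    exists2 f, F f & forall y, `|y - c.1| <= c.2 -> b.1%:R < ev f y].
  have [[Vb b0]|nb] := pselect (V b.2.1 /\ 0 < b.2.2).
    by have [c Pc] := step b.1 _ _ Vb b0; exists c.
  by exists b.2 => Vb b0; exfalso; apply: nb.
have [next nextP] := choice step'.
pose fix ar n : X * R := if n is m.+1 then next (m, ar m) else (0, 1).
have arP n : V (ar n).1 /\ 0 < (ar n).2.
  elim: n => [|n [Vn n0]] /=; first by split=> //; have [] := sV.
  by have [] := nextP (n, ar n) Vn n0.
have arS n := nextP (n, ar n) (arP n).1 (arP n).2.
have rn n : (ar n).2 <= 2^-1 ^+ n.
  elim: n => [|n ih]; first by rewrite expr0.
  have [_ _ h _ _] := arS n; rewrite exprS -[ar n.+1]/(next (n, ar n)).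
  move: h ih => /=; lra.
have nested n m : `|(ar (m + n)%N).1 - (ar n).1| + (ar (m + n)%N).2 <= (ar n).2.
  elim: m => [|m ih]; first by rewrite add0n subrr normr0 add0r.
  have [_ _ _ h _] := arS (m + n)%N; rewrite addSn -[ar (m + n).+1]/(next (_, ar _)).
  have := ler_distD (ar (m + n)%N).1 (next ((m + n)%N, ar (m + n)%N)).1 (ar n).1.
  by move: h ih => /=; lra.
have near_ar n m : (n <= m)%N -> `|(ar m).1 - (ar n).1| <= (ar n).2.
  move=> nm; have := nested n (m - n)%N; rewrite subnK//.
  have [_] := arP m; lra.
pose a n := (ar n).1.
have : cvg (a @ \oo).
  apply: cauchy_cvg; apply: cauchy_exP => e e0.
  have [n ne] : exists n, (2^-1 : R) ^+ n < e.
    have : (fun n => (2^-1 : R) ^+ n) @ \oo --> 0.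
      by apply: cvg_expr; rewrite gtr0_norm ?invr_gt0// invf_lt1// ltr1n.
    move=> /cvgrPdist_lt/(_ _ e0)[n _ /(_ n (leqnn n))].
    by rewrite /= sub0r normrN gtr0_norm ?exprn_gt0 ?invr_gt0//; exists n.
  exists (a n); exists n => // m nm; rewrite -ball_normE /ball_ /= distrC.
  by apply: le_lt_trans (near_ar _ _ nm) _; exact: le_lt_trans (rn n) ne.
move=> /cvg_ex[l al].
have Vl : V l.
  by apply: (@closed_cvg _ _ _ _ _ V cV _ _ al); apply: nearW => n; have [] := arP n.
have lr n : `|l - a n| <= (ar n).2.
  apply/ler_addgt0Pl => e e0.
  move: al => /cvgrPdist_lt/(_ _ e0)[m _ /(_ (m + n)%N (leq_addr _ _))] /= lm.
  have := ler_distD (a (m + n)%N) l (a n).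
  have := near_ar _ _ (leq_addl m n); rewrite -!/(a _); lra.
have [M FM] := Fpt l Vl.
have [n Mn] : exists n : nat, M <= n%:R.
  by exists (Num.truncn M).+1; apply/ltW/truncnS_gt.
(* The limit [l] lies in ball [n + 1], where this [f] exceeds [n >= M]. *)
have [_ _ _ _ [f Ff fn]] := arS n.
have := fn l (lr n.+1); have := FM f Ff; lra.
Qed.

(** * Functionals vanishing on a subspace *)

Section Annihilators.
Context {R : realType} {X : normedModType R}.
Implicit Types (f g h : dual X) (u v w : X) (V : set X).

Definition vanishes V h := forall v, V v -> ev h v = 0.

(** For a linear subspace this amounts to norm closedness; in this form it passes easily to [V]
    enlarged by one vector. *)
Definition weakly_closed V := forall w, ~ V w ->
  exists2 h, vanishes V h & ev h w = 1.

Lemma closed_weakly_closed V : closed V -> linear_subspace V -> weakly_closed V.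
Proof.
move=> cV sV w Vw; have [V0 VD] := sV.
have [d d0 dV] : exists2 d : R, 0 < d & forall v, V v -> d <= `|w - v|.
  have : nbhs w (~` V) by apply: open_nbhs_nbhs; split=> //; exact: closed_openC.
  move=> /nbhs_normP[d /= d0 dV]; exists d => // v Vv.
  by rewrite leNgt; apply/negP => wv; exact: dV Vv.
(* The constraints are [h (v - w) <= -1] for [v] in [V]; norm [1 / d] suffices, [d] being a lower
   bound for the distance from [w] to [V]. *)
have [||t a b a' b' _ [-> Va] [-> Va']|a b [-> Va]|h [_ hC]] :=
    @dual_mazur_orlicz _ X (fun a b => b = -1 /\ V (a + w)) d^-1.
- by rewrite invr_ge0 ltW.
- by exists (- w), (-1); rewrite addNr.
- split; first ring.
  have -> : (1 - t) *: a + t *: a' + w = (1 - t) *: (a + w) + t *: (a' + w).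
    by apply: dual_separates => f; rewrite !evE; ring.
  by apply: VD => //; exact: linear_subspaceZ.
- rewrite subr_ge0 mulrC ler_pdivlMr// mul1r.
  by have := dV _ Va; rewrite opprD addrCA subrr addr0 normrN.
have hw v : V v -> ev h v <= ev h w - 1.
  by move=> Vv; have := hC (v - w) (-1); rewrite subrK evB => /(_ (conj erefl Vv)); lra.
have hw1 : 1 <= ev h w by have := hw 0 V0; rewrite ev0; lra.
(* A functional bounded above on a subspace vanishes there: a positive value could be rescaled to
   reach [h w]. *)
have hV v : V v -> ev h v <= 0.
  move=> Vv; rewrite leNgt; apply/negP => hv.
  have := hw _ (linear_subspaceZ (ev h w / ev h v) sV Vv); rewrite evZ divfK ?gt_eqF//; lra.
exists ((ev h w)^-1 *: h) => [v Vv|]; rewrite evZl; last by rewrite mulVf// gt_eqF//; lra.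
have := hV _ Vv; have := hV _ (linear_subspaceN sV Vv); rewrite evN => h1 h2.
have -> : ev h v = 0 by lra.
exact: mulr0.
Qed.

(** For [u] outside [V], let [h] vanish on [V] with [h u = 1]. If [k] vanishes on [V] and is [1] at
    [w - h(w) u], then [k - k(u) h] also kills [u] and is [1] at [w]. *)
Lemma weakly_closed_adjoin V u : linear_subspace V -> weakly_closed V ->
  weakly_closed [set x | exists2 v, V v & exists t : R, x = v + t *: u].
Proof.
move=> sV wV; have [Vu w nw|/wV[h hV hu]] := pselect (V u).
  have [Vw|h hV hw] := wV w.
    by apply: nw; exists w => //; exists 0; rewrite scale0r addr0.
  exists h => // _ [v Vv [t ->]].
  by apply: hV; apply: linear_subspaceD => //; exact: linear_subspaceZ.
move=> w nw; have [|k kV kw] := wV (w - ev h w *: u).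
  by move=> Vw; apply: nw; exists (w - ev h w *: u) => //; exists (ev h w); rewrite subrK.
exists (k - ev k u *: h) => [_ [v Vv [t ->]]|].
  by rewrite !evE hV// kV// hu; ring.
by move: kw; rewrite !evE => <-; ring.
Qed.

(** Splits [g] into [h], which vanishes on [V], and [g - h], which vanishes on the span of [u] and
    [v]. The cases follow the dimension of that span modulo [V]. *)
Lemma vanishing_extension V (g : dual X) u v : linear_subspace V -> weakly_closed V ->
  (forall s t : R, V (s *: u + t *: v) -> ev g (s *: u + t *: v) = 0) ->
  exists2 h, vanishes V h & ev h u = ev g u /\ ev h v = ev g v.
Proof.
move=> sV wV gV.
have [Vu|/wV[h hV hu]] := pselect (V u).
  have gu : ev g u = 0.
    by have := gV 1 0; rewrite scale1r scale0r addr0; exact.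
  have [Vv|/wV[h hV hv]] := pselect (V v).
    exists 0 => //; rewrite gu; split=> //.
    by have := gV 0 1; rewrite scale1r scale0r add0r => ->.
  exists (ev g v *: h) => [x Vx|]; first by rewrite !evE hV// mulr0.
  by rewrite !evE hv (hV _ Vu) gu mulr0 mulr1.
have [Vv|/wV[k kV kv]] := pselect (V (v - ev h v *: u)).
  exists (ev g u *: h) => [x Vx|]; first by rewrite !evE hV// mulr0.
  rewrite !evE hu mulr1; split=> //.
  have := gV (- ev h v) 1; rewrite scale1r scaleNr addrC => /(_ Vv).
  by rewrite !evE; lra.
(* Here [u] and [v] are independent modulo [V]: [h] is [1] at [u], while [k - k(u) h] is [0] at [u]
   and [1] at [v]. *)
exists (ev g u *: h + (ev g v - ev g u * ev h v) *: (k - ev k u *: h)).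
  by move=> x Vx; rewrite !evE kV// hV//; ring.
move: kv; rewrite !evE hu => kv; split; first ring.
have -> : ev k v = 1 + ev h v * ev k u by lra.
ring.
Qed.

End Annihilators.

(** * Maximality, the convex hull of the graph, and selections *)

Section Monotone.
Context {R : realType} {X : normedModType R}.
Implicit Types (T S : X -> set (dual X)) (x y z u v w : X) (f g q : dual X).

Definition related T z f := forall y g, T y g -> 0 <= ev (g - f) (y - z).

(** A related pair outside the graph could be added to it without losing monotonicity. *)
Lemma maximal_monotoneP T :
  maximal_monotone T <->
  monotone_op T /\ forall z f, related T z f -> T z f.
Proof.
split=> [[mT maxT]|[mT relT]]; last first.
  split=> // -[S [mS [TS ST]]]; apply: ST => -[z f] Szf.
  by apply: relT => y g /(TS (y, g)) Syg; exact: mS.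
split=> // z f zf; apply: contrapT => nT; apply: maxT.
exists (fun x g => T x g \/ (x = z /\ g = f)); split.
  move=> x y g h [Txg|[-> ->]] [Tyh|[-> ->]]; first exact: mT.
  - exact: zf.
  - have := zf _ _ Tyh; rewrite -[(f - h) _]/(ev (f - h) _) !evE; lra.
  - by rewrite -[(f - f) _]/(ev (f - f) _) subrr.
split=> [[x g] Txg|/(_ (z, f))]; first by left.
by move=> /(_ (or_intror (conj erefl erefl))).
Qed.

(* Convex hull of the triples [(x, f, f x)] with [(x, f)] in the graph. *)
Inductive graph_hull T : X -> dual X -> R -> Prop :=
| hull_graph x f : T x f -> graph_hull T x f (ev f x)
| hull_convex (t : R) x f (s : R) x' f' (s' : R) : 0 <= t <= 1 ->
    graph_hull T x f s -> graph_hull T x' f' s' ->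
    graph_hull T ((1 - t) *: x + t *: x') ((1 - t) *: f + t *: f')
      ((1 - t) * s + t * s').

Lemma hull_affine T (h : X -> dual X -> R -> R) :
  (forall (t : R) x f (s : R) x' f' (s' : R),
    h ((1 - t) *: x + t *: x') ((1 - t) *: f + t *: f') ((1 - t) * s + t * s') =
    (1 - t) * h x f s + t * h x' f' s') ->
  (forall x f, T x f -> 0 <= h x f (ev f x)) ->
  forall x f s, graph_hull T x f s -> 0 <= h x f s.
Proof.
move=> hA hT x f s; elim=> [|t {}x {}f {}s x' f' s' /andP[t0 t1] _ h0 _ h0'].
  exact: hT.
by rewrite hA addr_ge0// mulr_ge0// subr_ge0.
Qed.

(** With [s] in place of [<y, q>], relatedness becomes affine in [(y, q, s)] and so extends from the
    graph to its hull. *)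
Lemma hull_related T z f y q s : related T z f -> graph_hull T y q s ->
  ev f (y - z) <= s - ev q z.
Proof.
move=> zf; rewrite -subr_ge0.
apply: (@hull_affine T (fun y q s => s - ev q z - ev f (y - z))).
  by move=> t *; rewrite !evE; ring.
by move=> {}y g /zf; rewrite !evE; lra.
Qed.

(** Monotonicity, made affine in each of the two triples separately. For equal triples it reads
    [<x, f> <= s]. *)
Lemma hull_pairing T x f (s : R) y g (s' : R) : monotone_op T ->
  graph_hull T x f s -> graph_hull T y g s' -> ev f y + ev g x <= s + s'.
Proof.
move=> mT hx hy; rewrite -subr_ge0.
apply: (@hull_affine T (fun x f s => s + s' - (ev f y + ev g x))) hx.
  by move=> t *; rewrite !evE; ring.
move=> {s f}x f Txf.
have rx : related T x f by move=> z h Tzh; exact: mT.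
by have := hull_related rx hy; rewrite !evE; lra.
Qed.

Definition hull_dom T x := exists f s, graph_hull T x f s.

Lemma hull_dom_op T x : op_dom T x -> hull_dom T x.
Proof. by move=> [f Txf]; exists f, (ev f x); exact: hull_graph. Qed.

(** Mazur-Orlicz for the constraints [f (y - z + a) <= s - <z, q> + b]. Those with [(a, b) = (0, 0)]
    make [(z, f)] related to [T], so that [f] is in [T z] by maximality. *)
Lemma maximal_related_selection T z (A : X -> R -> Prop) (K : R) :
  maximal_monotone T -> op_graph T !=set0 -> 0 <= K -> A 0 0 ->
  (forall (t : R) a b a' b', 0 <= t <= 1 -> A a b -> A a' b' ->
     A ((1 - t) *: a + t *: a') ((1 - t) * b + t * b')) ->
  (forall y q s a b, graph_hull T y q s -> A a b ->
     0 <= K * `|y - z + a| + (s - ev q z + b)) ->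
  exists2 f, T z f & forall a b, A a b -> ev f a <= b.
Proof.
move=> /maximal_monotoneP[mT relT] [[y0 g0] Tyg0] K0 A0 Acvx AK.
pose C c (d : R) := exists y q s a b,
  [/\ graph_hull T y q s, A a b, c = y - z + a & d = s - ev q z + b].
have [||c d|f [_ fC]] := @dual_mazur_orlicz _ X C K K0.
- by exists (y0 - z + 0), (ev g0 y0 - ev g0 z + 0), y0, g0, (ev g0 y0), 0, 0;
    split=> //; exact: hull_graph.
- move=> t c d c' d' t01 [y [q [s [a [b [hy Aab -> ->]]]]]]
    [y' [q' [s' [a' [b' [hy' Aab' -> ->]]]]]].
  exists ((1 - t) *: y + t *: y'), ((1 - t) *: q + t *: q'),
    ((1 - t) * s + t * s'), ((1 - t) *: a + t *: a'), ((1 - t) * b + t * b').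
  split; [exact: hull_convex|exact: Acvx| |by rewrite !evE; ring].
  by apply: dual_separates => h; rewrite !evE; ring.
- by move=> [y [q [s [a [b [hy Aab -> ->]]]]]]; exact: AK.
have Tzf : T z f.
  apply: relT => y g Tyg.
  have : C (y - z + 0) (ev g y - ev g z + 0).
    by exists y, g, (ev g y), 0, 0; split=> //; exact: hull_graph.
  by move=> /fC; rewrite !evE; lra.
(* Now [(z, f)] is itself in the graph; its own triple in the constraint leaves [f a <= b]. *)
exists f => // a b Aab.
have : C (z - z + a) (ev f z - ev f z + b).
  by exists z, f, (ev f z), a, b; split=> //; exact: hull_graph.
by move=> /fC; rewrite !subrr !add0r.
Qed.

End Monotone.

(** * Affine sets and their directions *)

Section Affine.
Context {R : realType} {X : normedModType R}.
Implicit Types (T : X -> set (dual X)) (x y z u v w : X) (f g q : dual X) (Y S : set X).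

(** The linear subspace parallel to a non-empty affine set, described without a base point. *)
Definition direction Y := [set w | forall x, Y x -> Y (x + w)].

Lemma direction_subspace Y : affine_set Y -> linear_subspace (direction Y).
Proof.
move=> aY; split; first by move=> x Yx; rewrite addr0.
move=> t w w' Yw Yw' x Yx; rewrite addrA; apply: Yw'.
have -> : x + t *: w = (1 - t) *: x + t *: (x + w).
  by apply: dual_separates => f; rewrite !evE; ring.
by apply: aY => //; exact: Yw.
Qed.

Lemma directionB Y x y : affine_set Y -> Y x -> Y y -> direction Y (x - y).
Proof.
move=> aY Yx Yy u Yu.
(* The reflection of [y] in the midpoint of [u] and [x]. *)
have -> : u + (x - y) = (1 - 2) *: y + 2 *: ((1 - 2^-1) *: u + 2^-1 *: x).
  by apply: dual_separates => f; rewrite !evE; field.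
by apply: (aY) => //; exact: aY.
Qed.

Lemma direction_closed Y : closed Y -> closed (direction Y).
Proof.
move=> cY; have -> : direction Y = \bigcap_(x in Y) ((fun w => x + w) @^-1` Y).
  by apply/seteqP; split=> w h x Yx; exact: h.
apply: closed_bigI => x _; apply: closed_comp => // w _.
exact: (cvgD (cvg_cst _) cvg_id).
Qed.

Lemma aff_affine S : affine_set (aff S).
Proof.
by move=> x y t Sx Sy B PB; have [aB _] := PB; apply: aB; [exact: Sx|exact: Sy].
Qed.

Lemma sub_aff S : S `<=` aff S.
Proof. by move=> x Sx B [_]; exact. Qed.

Lemma hull_dom_aff T x : hull_dom T x -> aff (op_dom T) x.
Proof.
move=> [f [s]]; elim=> [{}x {}f Txf|t {}x {}f {}s x' f' s' _ _ Yx _ Yx'].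
  by apply: sub_aff; exists f.
exact: aff_affine.
Qed.

End Affine.

(** * Bounded points *)

Section BoundedPoints.
Context {R : realType} {X : normedModType R}.
Variable T : X -> set (dual X).
Implicit Types (x y z u v w c : X) (f g q : dual X).
Hypothesis mT : monotone_op T.

Let Y := aff (op_dom T).
Let V := direction Y.

Definition uniformly_bounded_at c (r M : R) := forall w y q (s : R),
  direction (aff (op_dom T)) w -> `|w| <= r -> graph_hull T y q s ->
  ev q (c + w) - s <= M * (1 + `|y|).

Definition bounded_point c := aff (op_dom T) c /\
  exists r M : R, [/\ 0 < r, 0 <= M & uniformly_bounded_at c r M].

Let sV : linear_subspace V.
Proof. exact: direction_subspace (@aff_affine _ _ _). Qed.

(** Pairing with a fixed triple above [x] bounds [<x, q> - s] by [s' - <y, g>], which grows at most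
    linearly in [|y|]; hence the weight [1 + |y|]. *)
Lemma hull_dom_bound x : hull_dom T x ->
  exists2 M : R, 0 <= M & forall y q (s : R), graph_hull T y q s ->
    ev q x - s <= M * (1 + `|y|).
Proof.
move=> [g [s' hx]]; have [L L0 gL] := ev_bounded g.
exists (`|s'| + L); first by rewrite addr_ge0// ltW.
move=> y q s hy; have := hull_pairing mT hx hy.
have := gL y; rewrite ler_norml => /andP[+ _].
have := ler_norm s'; have := mulr_ge0 (normr_ge0 s') (normr_ge0 y).
nra.
Qed.

(** The whole perturbation is put on [c], as [w / (1 - t)], so the radius shrinks by the factor
    [1 - t]; at [x] the bound without perturbation is enough. *)
Lemma bounded_point_segment c x (t : R) : 0 <= t < 1 ->
  bounded_point c -> hull_dom T x -> bounded_point ((1 - t) *: c + t *: x).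
Proof.
move=> /andP[t0 t1] [Yc [r [M [r0 M0 cM]]]] hx.
have [M' M'0 xM] := hull_dom_bound hx.
have t1' : 0 < 1 - t by lra.
split; first by apply: aff_affine => //; exact: hull_dom_aff.
exists ((1 - t) * r), (M + M'); split; [exact: mulr_gt0|exact: addr_ge0|].
move=> w y q s Vw wr hy.
have {}Vw : V ((1 - t)^-1 *: w) by exact: (linear_subspaceZ _ sV).
have := cM _ _ _ _ Vw _ hy; rewrite normrZ gtr0_norm ?invr_gt0//.
rewrite ler_pdivrMl// => /(_ wr); rewrite !evE => h1.
have h2 := xM _ _ _ hy.
have y0 : 0 <= 1 + `|y| by rewrite addr_ge0.
have : (1 - t) * (ev q c + (1 - t)^-1 * ev q w - s) + t * (ev q x - s) <=
    (1 - t) * (M * (1 + `|y|)) + t * (M' * (1 + `|y|)).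
  by rewrite lerD// ler_wpM2l// ltW.
rewrite mulrBr mulrDr mulVKf ?gt_eqF//.
have := mulr_ge0 M0 y0; have := mulr_ge0 M'0 y0; nra.
Qed.

Lemma bounded_point_near c : bounded_point c ->
  exists2 r : R, 0 < r & forall w, V w -> `|w| <= r -> bounded_point (c + w).
Proof.
move=> [Yc [r [M [r0 M0 cM]]]]; exists (r / 2); first by rewrite divr_gt0.
move=> w Vw wr; split; first exact: Vw.
exists (r / 2), M; split=> //; first by rewrite divr_gt0.
move=> w' y q s Vw' w'r hy; rewrite -addrA; apply: cM => //.
  exact: (linear_subspaceD sV Vw Vw').
by have := ler_normD w w'; lra.
Qed.

Lemma hull_direction x y q (s : R) : aff (op_dom T) x -> graph_hull T y q s ->
  V (y - x).
Proof.
move=> Yx hy; apply: directionB => //; first exact: aff_affine.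
by apply: hull_dom_aff; exists q, s.
Qed.

Hypothesis maxT : maximal_monotone T.
Hypothesis T0 : op_graph T !=set0.

(** A selection with no extra constraint: [s - <z, q>] has to be bounded below by [- K |y - z|]. *)
Lemma bounded_point_dom z : bounded_point z -> op_dom T z.
Proof.
move=> [Yz [r [M' [r0 M'0 zM']]]].
pose M := M' * (1 + `|z|); have M0 : 0 <= M by rewrite mulr_ge0// addr_ge0.
have zM w y q s : V w -> `|w| <= r -> graph_hull T y q s ->
    ev q z + ev q w - s <= M * (1 + `|y - z|).
  move=> Vw wr hy; rewrite -evD; apply: le_trans (zM' _ _ _ _ Vw wr hy) _.
  rewrite /M -mulrA ler_wpM2l//.
  have := ler_normD (y - z) z; rewrite subrK.
  have := mulr_ge0 (normr_ge0 z) (normr_ge0 (y - z)); lra.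
(* The first term serves for [|y - z| >= 1], the second for [|y - z| < 1]. *)
pose K := 2 * M + 2 * M / r.
have Mr0 : 0 <= 2 * M / r by rewrite divr_ge0 ?mulr_ge0// ltW.
have [||t a b a' b' _ [-> ->] [-> ->]|y q s a b hy [-> ->]|f Tzf _] :=
  @maximal_related_selection _ _ T z (fun a b => a = 0 /\ b = 0) K maxT T0.
- by rewrite /K addr_ge0// mulr_ge0.
- by [].
- by rewrite !scaler0 !mulr0 !addr0.
- rewrite !addr0 {a b}; set a := `|y - z|; have a0 : 0 <= a by exact: normr_ge0.
  have s1 : ev q y <= s by have := hull_pairing mT hy hy; lra.
  have [a1|a1] := leP 1 a.
    have := zM 0 y q s _ _ hy; rewrite ev0 normr0 addr0 -/a => /(_ sV.1 (ltW r0)).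
    have := mulr_ge0 M0 a0; have := mulr_ge0 Mr0 a0; rewrite /K; nra.
  have [a_eq0|aN0] := eqVneq a 0.
    have yz : y - z = 0 by apply/normr0_eq0.
    have -> : z = y by apply/esym/eqP; rewrite -subr_eq0 yz.
    by rewrite a_eq0 mulr0; lra.
  have {}a0 : 0 < a by rewrite lt0r aN0.
  (* A perturbation of norm [r] pointing away from [y] bounds [<y - z, q>] below; with [<y, q> <= s]
     this controls [s - <z, q>]. *)
  have := zM (- (r / a) *: (y - z)) y q s
    (linear_subspaceZ _ sV (hull_direction Yz hy)) _ hy.
  rewrite normrZ normrN gtr0_norm ?divr_gt0// -/a divfK// => /(_ (lexx _)).
  rewrite !evE => h.
  have : r / a * (ev q y - ev q z) >= - (2 * M + (s - ev q z)).
    have := mulr_ge0 M0 (ltW a0); nra.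
  rewrite -ler_pdivrMl ?divr_gt0// invf_div => {}h.
  have [s0|s0] := leP 0 (s - ev q z).
    have K0 : 0 <= K by rewrite /K addr_ge0// mulr_ge0.
    by apply: addr_ge0 => //; apply: mulr_ge0 => //; exact: ltW.
  have ar : 0 < a / r by rewrite divr_gt0.
  have : 2 * M / r * a = a / r * (2 * M) by rewrite mulrC mulrA mulrAC.
  have := mulr_ge0 M0 (ltW a0).
  rewrite /K mulrDl; nra.
by exists f.
Qed.

End BoundedPoints.

(** The algebraic interior gives a bound in each direction of [V] separately; uniform boundedness,
    on the closed subspace [V], makes it uniform for small [w]. *)
Lemma ic_bounded_point (R : realType) (X : completeNormedModType R)
    (T : X -> set (dual X)) (c : X) :
  monotone_op T -> ic (op_dom T) c -> bounded_point T c.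
Proof.
move=> mT [cY [Dc coreD]]; pose V := direction (aff (op_dom T)).
have Yc : aff (op_dom T) c by exact: sub_aff.
have sV : linear_subspace V by exact: direction_subspace (@aff_affine _ _ _).
split=> //.
have bnd w : V w -> exists rho M : R, [/\ 0 < rho, 0 <= M &
    forall y q s, graph_hull T y q s ->
      rho * ev q w + ev q c - s <= M * (1 + `|y|)].
  move=> Vw; have [rho rho0 Drho] := coreD _ (Vw _ Yc).
  have /hull_dom_op/(hull_dom_bound mT)[M M0 hM] :
      op_dom T ((1 - rho) *: c + rho *: (c + w)).
    by apply: Drho; rewrite lexx ltW.
  exists rho, M; split=> // y q s /hM; rewrite !evE; lra.
have [rho1 [C0 [_ C00 hC0]]] := bnd 0 sV.1.
(* A normalisation: [D] is positive on the hull, the functionals [q / D] are pointwise bounded above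
   on [V], and [<w, q> <= D] is exactly the bound wanted at [c + w]. *)
pose D (y : X) (q : dual X) (s : R) := (C0 + 1) * (1 + `|y|) - ev q c + s.
have Dge y q s : graph_hull T y q s -> 1 + `|y| <= D y q s.
  by move=> /hC0; rewrite ev0 mulr0 add0r /D; lra.
have y1 (y : X) : 1 <= 1 + `|y| by rewrite lerDl.
have D1 y q s : graph_hull T y q s -> 0 < D y q s.
  by move=> /Dge; have := y1 y; lra.
have [v Vv|M M0 FM] := @closed_subspace_uniform_boundedness R X V
    [set f | exists y q s, graph_hull T y q s /\ f = (D y q s)^-1 *: q]
    (direction_closed cY) sV.
  have [rho [M [rho0 M0 hM]]] := bnd v Vv; exists ((1 + M) / rho).
  move=> _ [y [q [s [hy ->]]]]; rewrite evZl ler_pdivlMr// -mulrA.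
  rewrite ler_pdivrMl; last exact: D1.
  have := hM _ _ _ hy; have := Dge _ _ _ hy.
  have := mulr_ge0 C00 (normr_ge0 y); rewrite /D.
  have := ler_wpM2l M0 (Dge _ _ _ hy); have := normr_ge0 y; rewrite /D; lra.
exists M^-1, (C0 + 1); split; [by rewrite invr_gt0|lra|].
move=> w y q s Vw wM hy.
have := FM ((D y q s)^-1 *: q) w; rewrite evZl ler_pdivrMl ?D1// => h.
have {h} : ev q w <= D y q s * (M * `|w|) by apply: h => //; exists y, q, s.
have : M * `|w| <= 1 by rewrite -ler_pdivlMl// mulr1.
move=> /(ler_wpM2l (ltW (D1 _ _ _ hy))); rewrite mulr1 evE /D; lra.
Qed.

(** * Following a segment from a bounded point *)

Section Segments.
Context {R : realType} {X : normedModType R}.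
Variable T : X -> set (dual X).
Implicit Types (x y z u v w c p : X) (f g q : dual X).
Hypotheses (maxT : maximal_monotone T) (T0 : op_graph T !=set0).

Let mT : monotone_op T := maxT.1.
Let Y := aff (op_dom T).
Let V := direction Y.
Let aY : affine_set Y := @aff_affine _ _ _.
Let sV : linear_subspace V := direction_subspace aY.

Lemma graph_related x f : T x f -> related T x f.
Proof. by move=> Txf y g Tyg; exact: mT. Qed.

(* As [x] is not a bounded point, [x + mu (x - c)] stays at distance at least
   [mu r] from the hull of the domain, which leaves room for arbitrarily steep
   functionals in [T x]. *)
Lemma unbounded_off_bounded_points c x (L : R) :
  bounded_point T c -> op_dom T x -> ~ bounded_point T x ->
  exists2 f, T x f & L <= ev f (x - c).
Proof.
move=> bc [f0 Txf0] nbx.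
have Yx : Y x by apply: sub_aff; exists f0.
have Yc : Y c := bc.1.
have [r r0 br] := bounded_point_near bc.
have [K0 K0_gt0 f0K] := ev_bounded f0.
have := directionB aY Yx Yc; have : c + (x - c) = x by rewrite addrC subrK.
move: (x - c) => e cex Ve.
have far (mu : R) y q s : 0 <= mu -> graph_hull T y q s -> mu * r <= `|y - x - mu *: e|.
  move=> mu0 hy; have [->|muN0] := eqVneq mu 0; first by rewrite mul0r.
  have {muN0}mu0 : 0 < mu by rewrite lt0r muN0.
  rewrite leNgt; apply/negP => d; apply: nbx.
  (* If the distance were smaller, [|w| <= r] would make [c + w] a bounded point, and [x] lies on
     the segment from [c + w] to [y]. *)
  pose w := - (mu^-1 *: (y - x - mu *: e)).
  have Vw : V w.
    apply: (linear_subspaceN sV); apply: (linear_subspaceZ _ sV).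
    apply: (linear_subspaceB sV); last exact: (linear_subspaceZ _ sV).
    exact: hull_direction hy.
  have wr : `|w| <= r.
    by rewrite normrN normrZ gtr0_norm ?invr_gt0// ler_pdivrMl// ltW.
  have m1 : 0 < 1 + mu by lra.
  have -> : x = (1 - (1 + mu)^-1) *: (c + w) + (1 + mu)^-1 *: y.
    apply: dual_separates => f; rewrite /w -cex !evE; field.
    by rewrite !gt_eqF.
  apply: bounded_point_segment => //; last by exists q, s.
    by rewrite invr_ge0 ltW//= invf_lt1//; lra.
  exact: br.
(* [K0] accounts for the known element [f0]; the second term pays for raising the slope along [e]
   from [f0 e] to [L], by [far]. *)
pose K := K0 + (`|L| + `|ev f0 e|) / r.
have K_ge0 : 0 <= K by rewrite addr_ge0 ?divr_ge0 ?addr_ge0// ltW.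
have [|t a b a' b' /andP[t0 t1] [m m0 [-> ->]]
    [m' m'0 [-> ->]]|
    y q s a b hy [m m0 [-> ->]]|f Txf fA] :=
  @maximal_related_selection _ _ T x
    (fun a b => exists2 mu : R, 0 <= mu & a = - (mu *: e) /\ b = - (mu * L)) K
    maxT T0 K_ge0.
- by exists 0; rewrite // scale0r mul0r !oppr0.
- exists ((1 - t) * m + t * m'); first by rewrite addr_ge0// mulr_ge0// subr_ge0.
  split; last by ring.
  by apply: dual_separates => f; rewrite !evE; ring.
- have d := far m y q s m0 hy; set d0 := `|_| in d *.
    have := f0K (y - x - m *: e); rewrite ler_norml => /andP[+ _].
  rewrite -/d0 !evE.
  have := hull_related (graph_related Txf0) hy; rewrite !evE.
  have : (`|L| + `|ev f0 e|) / r * d0 >= m * (L - ev f0 e).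
    have h1 := ler_norm L; have h2 := ler_norm (- ev f0 e); rewrite normrN in h2.
    have h3 : m <= d0 / r by rewrite ler_pdivlMr.
    have h4 : 0 <= `|L| + `|ev f0 e| by rewrite addr_ge0.
    rewrite mulrAC -mulrA; have := ler_wpM2l h4 h3.
    have := ler_wpM2l m0 (lerD h1 h2); lra.
  rewrite /K; lra.
exists f => //; have := fA (- (1 *: e)) (- (1 * L)); rewrite scale1r mul1r evN.
by rewrite lerN2; apply; exists 1; rewrite ?scale1r ?mul1r.
Qed.

(** Let [t0] be the supremum of the parameters of bounded points. Up to [t0] the bound [beta] keeps
    the values of [T] uniformly bounded on [V], so a selection exists at [t0] too; and [t0 < 1] is
    impossible. *)
Lemma dom_of_segment_bound c z (beta : R) :
  bounded_point T c -> Y z ->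
  (forall (t : R) f, 0 <= t < 1 -> T (c + t *: (z - c)) f -> ev f (z - c) <= beta) ->
  exists2 f, T z f & ev f (z - c) <= beta.
Proof.
move=> bc Yz; have Yc : Y c := bc.1; have := directionB aY Yz Yc.
have : c + (z - c) = z by rewrite addrC subrK.
move: (z - c) => e cez Ve seg.
have [_ [r [M [r0 M0 cM]]]] := bc.
pose J : set R := [set t | 0 <= t < 1 /\ bounded_point T (c + t *: e)].
have J0 : J 0 by split; rewrite ?lexx ?ltr01// scale0r addr0.
have J1 t : J t -> t <= 1 by move=> [/andP[_ /ltW]].
have supJ : has_sup J by split; [exists 0|exists 1 => t /J1].
pose t0 := sup J.
have t00 : 0 <= t0 by apply: sup_ubound => //; exact: supJ.2.
have t01 : t0 <= 1 by apply: ge_sup => //; exists 0.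
pose x := c + t0 *: e.
have Yx : Y x by apply: (linear_subspaceZ _ sV Ve).
pose B := `|beta| + M * (1 + (`|c| + `|e|)).
have B0 : 0 <= B by rewrite addr_ge0// mulr_ge0// ?addr_ge0.
pose K := B / r; have K0 : 0 <= K by rewrite divr_ge0// ltW.
have fK t f w : J t -> T (c + t *: e) f -> V w -> ev f w <= K * `|w|.
  move=> [/andP[t0' t1'] _] Tf Vw.
  have [->|w0] := eqVneq w 0; first by rewrite ev0 normr0 mulr0.
  have nw0 : 0 < `|w| by rewrite normr_gt0.
  have := cM ((r / `|w|) *: w) _ _ _ (linear_subspaceZ _ sV Vw) _ (hull_graph Tf).
  rewrite normrZ gtr0_norm ?divr_gt0// divfK ?gt_eqF// => /(_ (lexx _)).
  rewrite !evE => h.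
  have h1 : `|c + t *: e| <= `|c| + `|e|.
    apply: le_trans (ler_normD _ _) _; rewrite lerD2l normrZ ger0_norm//.
    by rewrite ler_piMl// ltW.
  have h2 : t * ev f e <= `|beta|.
    have := seg t f; rewrite t0' t1' => /(_ isT Tf) fb.
    have := ler_norm beta; have := ler_wpM2l t0' fb.
    have := ler_wpM2l t0' (ler_norm beta).
    have := ler_wpM2r (normr_ge0 beta) (ltW t1'); lra.
  have h3 := ler_wpM2l M0 h1.
  have : r / `|w| * ev f w <= B by rewrite /B; lra.
  rewrite -ler_pdivlMl ?divr_gt0// invf_div => h4.
  have -> : K * `|w| = `|w| / r * B by rewrite /K; ring.
  exact: h4.
have [|t a b a' b' /andP[t0' t1'] [m m0 [-> ->]]
    [m' m'0 [-> ->]]|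
    y q s a b hy [m m0 [-> ->]]|f Txf fA] :=
  @maximal_related_selection _ _ T x
    (fun a b => exists2 mu : R, 0 <= mu & a = mu *: e /\ b = mu * beta) K maxT T0 K0.
- by exists 0; rewrite // scale0r mul0r.
- exists ((1 - t) * m + t * m'); first by rewrite addr_ge0// mulr_ge0// subr_ge0.
  split; last by ring.
  by apply: dual_separates => f; rewrite !evE; ring.
(* The inequality at [x] is approached from some [t] in [J] near [t0]: moving the base point costs
   [(t0 - t) (<e, q> - <e, f>)], which [N] keeps below [eps]. *)
- apply/ler_addgt0Pl => eps eps0.
  pose N := K * `|e| + `|ev q e| + 1.
  have N0 : 0 < N.
    rewrite /N; have := mulr_ge0 K0 (normr_ge0 e); have := normr_ge0 (ev q e); lra.
  have [t Jt tt0] := sup_adherent (divr_gt0 eps0 N0) supJ.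
  have tle : t <= t0 by apply: sup_ubound => //; exact: supJ.2.
  have [f Tf] := bounded_point_dom mT maxT T0 Jt.2.
  have h1 := hull_related (graph_related Tf) hy.
  have Vy : V (y - x + m *: e).
    apply: (linear_subspaceD sV); first exact: hull_direction hy.
    exact: (linear_subspaceZ _ sV).
  have h2 := fK t f _ Jt Tf (linear_subspaceN sV Vy).
  have h3 := fK t f _ Jt Tf (linear_subspaceN sV Ve).
  have h4 : m * ev f e <= m * beta.
    by rewrite ler_wpM2l//; apply: (seg t) => //; exact: Jt.1.
  have h5 : (t0 - t) * N <= eps by rewrite -ler_pdivlMr//; rewrite -/t0 in tt0; lra.
  have h6 : 0 <= t0 - t by lra.
  have h7 : (t0 - t) * (- ev f e) <= (t0 - t) * (K * `|e|).
    by apply: ler_wpM2l => //; move: h3; rewrite evN normrN.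
  have h8 := ler_wpM2l h6 (ler_norm (ev q e)).
  move: h1 h2; rewrite normrN /x !evE; move: h5; rewrite /N.
  lra.
have fb : ev f e <= beta.
  have := fA (1 *: e) (1 * beta); rewrite scale1r mul1r; apply.
  by exists 1; rewrite ?scale1r ?mul1r.
have [t0_lt1|t0_ge1] := ltP t0 1; last first.
  have t1 : t0 = 1 by lra.
  have xz : x = z by rewrite /x t1 scale1r.
  by rewrite -xz; exists f => //; rewrite xz.
(* A bounded [x] would have bounded points beyond it on the segment; any other [x] admits elements
   of [T x] too steep for [beta]. *)
exfalso.
have [bx|nbx] := pselect (bounded_point T x).
  have [r' r'0 br] := bounded_point_near bx.
  pose d := Num.min ((1 - t0) / 2) (r' / (`|e| + 1)).
  have e1 : 0 < `|e| + 1 by have := normr_ge0 e; lra.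
  have d0 : 0 < d by rewrite lt_min !divr_gt0//; lra.
  have d1 : d <= (1 - t0) / 2 by rewrite ge_min lexx.
  have d2 : d <= r' / (`|e| + 1) by rewrite ge_min lexx orbT.
  have : J (t0 + d).
    split; first lra.
    rewrite scalerDl addrA; apply: br; first exact: (linear_subspaceZ _ sV).
    rewrite normrZ gtr0_norm//; move: d2; rewrite ler_pdivlMr//; lra.
  by move=> /(sup_ubound supJ.2); rewrite -/t0; lra.
have Dx : op_dom T x by exists f.
have [g Tg] := @unbounded_off_bounded_points c x (t0 * beta + 1) bc Dx nbx.
have -> : x - c = t0 *: e by rewrite /x addrAC subrr add0r.
rewrite evZ.
have := seg t0 g; rewrite t00 t0_lt1 => /(_ isT Tg) gb.
have := ler_wpM2l t00 gb; lra.
Qed.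

End Segments.

(** * Selections prescribed on an affine set *)

Section SumWithNormalCone.
Context {R : realType} {X : normedModType R}.
Variable T : X -> set (dual X).
Implicit Types (x y z u v w c p : X) (f g h q : dual X) (P W : set X).
Hypotheses (maxT : maximal_monotone T) (T0 : op_graph T !=set0).

Let mT : monotone_op T := maxT.1.
Let Y := aff (op_dom T).
Let V := direction Y.
Let aY : affine_set Y := @aff_affine _ _ _.
Let sV : linear_subspace V := direction_subspace aY.

(** Relatedness to [T] only tests [f] on differences of points of the domain, and these lie in
    [V]. *)
Lemma maximal_add_vanishing x f h : T x f -> vanishes V h -> T x (f + h).
Proof.
move=> Txf Vh; have [_] := (maximal_monotoneP T).1 maxT; apply=> y g Tyg.
have Yx : Y x by apply: sub_aff; exists f.
have Yy : Y y by apply: sub_aff; exists g.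
have := mT Tyg Txf; rewrite -[(g - f) _]/(ev (g - f) _).
by have := Vh _ (directionB aY Yy Yx); rewrite !evE; lra.
Qed.

Lemma selection_on_affine_set P c z f0 :
  affine_set P -> bounded_point T c -> P c -> P z -> Y z ->
  (forall x f, P x -> T x f -> 0 <= ev (f - f0) (x - z)) ->
  exists2 f, T z f & forall p, P p -> Y p -> ev f (p - z) = ev f0 (p - z).
Proof.
move=> aP bc Pc Pz Yz rel.
(* On the segment from [x] to [z] inside [P], [rel] is the bound required by [dom_of_segment_bound],
   with [beta = f0 (z - x)]. *)
have seg x : P x -> bounded_point T x ->
    exists2 f, T z f & ev f (z - x) <= ev f0 (z - x).
  move=> Px bx; apply: (dom_of_segment_bound maxT T0 bx Yz) => t f /andP[_ t1] Tf.
  have Pxt : P (x + t *: (z - x)).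
    have -> : x + t *: (z - x) = (1 - t) *: x + t *: z.
      by apply: dual_separates => g; rewrite !evE; ring.
    exact: aP.
  have := rel _ _ Pxt Tf.
  have -> : ev (f - f0) (x + t *: (z - x) - z) =
      (1 - t) * (ev f0 (z - x) - ev f (z - x)) by rewrite !evE; ring.
  by rewrite pmulr_rge0 ?subr_gt0// subr_ge0.
have [_ [r1 [M [r10 M0 cM]]]] := bc; have [r2 r20 br] := bounded_point_near bc.
pose r := Num.min r1 r2.
have r0 : 0 < r by rewrite lt_min r10.
have rr1 : r <= r1 by rewrite ge_min lexx.
have rr2 : r <= r2 by rewrite ge_min lexx orbT.
pose B := M * (1 + `|z|) + `|ev f0 (z - c)|.
have B0 : 0 <= B by rewrite addr_ge0// mulr_ge0// addr_ge0.
have K0 : 0 <= B / r by rewrite divr_ge0// ltW.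
have [|t a b a' b' _ [p [Pp Yp -> ->]] [p' [Pp' Yp' -> ->]]|
    y q s a b hy [p [Pp Yp -> ->]]|f Tf fA] :=
  @maximal_related_selection _ _ T z (fun a b => exists p,
    [/\ P p, Y p, a = z - p & b = ev f0 (z - p)]) _ maxT T0 K0.
- by exists z; rewrite subrr ev0.
- exists ((1 - t) *: p + t *: p'); split; [exact: aP|exact: aY| |].
    by apply: dual_separates => g; rewrite !evE; ring.
  by rewrite !evE; ring.
- apply/ler_addgt0Pl => eps eps0.
  have -> : y - z + (z - p) = y - p by rewrite addrA subrK.
  set d := `|y - p|.
  (* Slightly more than [d], so that [k > 0] even when [y = p]; the excess costs at most [eps]. *)
  pose d' := d + eps / (B / r + 1).
  have d0 : 0 <= d by exact: normr_ge0.
  have Br1 : 0 < B / r + 1 by lra.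
  have dd' : d < d' by rewrite ltrDl divr_gt0.
  have d'0 : 0 < d' by lra.
  have Kd' : B / r * d' <= eps + B / r * d.
    have -> : B / r * d' = B / r * d + eps * ((B / r) / (B / r + 1)).
      by rewrite /d'; ring.
    rewrite addrC lerD2r ler_piMr ?ltW// ltr_pdivrMr//; lra.
  pose k := d' / r; have k0 : 0 < k by rewrite divr_gt0.
  pose w := k^-1 *: (p - y).
  have Vw : V w.
    apply: (linear_subspaceZ _ sV); rewrite -opprB; apply: (linear_subspaceN sV).
    exact: hull_direction hy.
  have wr : `|w| <= r.
    rewrite normrZ gtr0_norm ?invr_gt0// distrC -/d ler_pdivrMl// /k divfK ?gt_eqF//.
    exact: ltW.
  have k1 : 0 < 1 + k by lra.
  (* By the choice of [w], [x] is also [(k c + p) / (1 + k)]: a bounded point as a combination of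
     [c + w] and [y], a point of [P] as one of [c] and [p]. *)
  pose x := (1 - (1 + k)^-1) *: (c + w) + (1 + k)^-1 *: y.
  have bx : bounded_point T x.
    apply: bounded_point_segment => //; last by exists q, s.
      by rewrite invr_ge0 ltW//= invf_lt1//; lra.
    by apply: br => //; exact: le_trans rr2.
  have Px : P x.
    have -> : x = (1 - (1 + k)^-1) *: c + (1 + k)^-1 *: p.
      apply: dual_separates => g; rewrite /x /w !evE; field.
      by rewrite !gt_eqF.
    exact: aP.
  have [f Tf fx] := seg x Px bx.
  have h1 : (1 + k) * ev f (z - x) <= (1 + k) * ev f0 (z - x).
    by rewrite ler_pM2l.
  have zx g : (1 + k) * ev g (z - x) = ev g (z - p) + k * ev g (z - c).
    rewrite /x /w !evE; field.
    by rewrite !gt_eqF.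
  rewrite !zx in h1.
  have := cM w z f _ Vw (le_trans wr rr1) (hull_graph Tf).
  rewrite evD => h2.
  have {h2} h2 : k * (ev f c + ev f w - ev f z) <= k * (M * (1 + `|z|)).
    by rewrite ler_pM2l.
  have kw : k * ev f w = ev f p - ev f y.
    by rewrite /w !evE mulrA divff ?gt_eqF// mul1r.
  have h3 := hull_related (graph_related maxT Tf) hy.
  have kB : k * B = B / r * d' by rewrite /k; ring.
  have h4 : k * ev f0 (z - c) <= k * `|ev f0 (z - c)|.
    by rewrite ler_pM2l// ler_norm.
  move: h1 h2 h3; rewrite !mulrDr mulrN kw !evE.
  have : k * B = k * (M * (1 + `|z|)) + k * `|ev f0 (z - c)| by rewrite /B mulrDr.
  rewrite !evE in h4 *; lra.
exists f => // p Pp Yp; apply/eqP; rewrite eq_le; apply/andP; split.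
  (* The reflection of [p] in [z] gives the opposite inequality. *)
  have : ev f (z - (2 *: z - p)) <= ev f0 (z - (2 *: z - p)).
    apply: fA; exists (2 *: z - p).
    have -> : 2 *: z - p = (1 - 2) *: p + 2 *: z.
      by apply: dual_separates => g; rewrite !evE; ring.
    by split=> //; [exact: aP|exact: aY].
  by rewrite !evE; lra.
have : ev f (z - p) <= ev f0 (z - p) by apply: fA; exists p.
by rewrite !evE; lra.
Qed.

End SumWithNormalCone.

(** * Maximality of the sum with the normal cone of a plane *)

Section Planes.
Context {R : realType} {X : normedModType R}.
Implicit Types (x y z u v w c p : X) (f g h q : dual X) (P W : set X).

Lemma linear_subspace_adjoin W u : linear_subspace W ->
  linear_subspace [set x | exists2 v, W v & exists t : R, x = v + t *: u].
Proof.
move=> sW; split; first by exists 0; [exact: sW.1|exists 0; rewrite scale0r addr0].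
move=> t _ _ [v Wv [a ->]] [v' Wv' [a' ->]].
exists (t *: v + v'); first exact: sW.2.
exists (t * a + a'); apply: dual_separates => f; rewrite !evE; ring.
Qed.

Lemma plane_affine P : plane P -> affine_set P.
Proof.
move=> [p [u [v [_ ->]]]] x y t [a [b ->]] [a' [b' ->]].
exists ((1 - t) * a + t * a'), ((1 - t) * b + t * b').
by apply: dual_separates => f; rewrite !evE; ring.
Qed.

Lemma span2_weakly_closed u v :
  weakly_closed [set x | exists a b : R, x = a *: u + b *: v].
Proof.
have s0 : linear_subspace [set (0 : X)].
  by split=> // t _ _ -> ->; rewrite scaler0 addr0.
have w0 : weakly_closed [set (0 : X)].
  apply: closed_weakly_closed => //; apply: accessible_closed_set1.
  exact: hausdorff_accessible.
have wuv := weakly_closed_adjoin (u := v) (linear_subspace_adjoin u s0)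
  (weakly_closed_adjoin (u := u) s0 w0).
move=> w nw; have [|h hW hw] := wuv w.
  move=> [_ [_ -> [a ->]] [b wE]]; apply: nw.
  by exists a, b; rewrite wE add0r.
exists h => // _ [a [b ->]]; apply: hW.
by exists (a *: u); [exists 0 => //; exists a; rewrite add0r|exists b].
Qed.

Lemma normal_cone_monotone P : monotone_op (normal_cone P).
Proof.
move=> x y f g [Px fP] [Py gP]; have := fP y Py; have := gP x Px.
rewrite -[f _]/(ev f _) -[g _]/(ev g _) -[(f - g) _]/(ev (f - g) _) !evE; lra.
Qed.

Theorem maximal_add_normal_cone (T : X -> set (dual X)) P c :
  maximal_monotone T -> op_graph T !=set0 ->
  closed (aff (op_dom T)) -> bounded_point T c ->
  plane P -> P c -> maximal_monotone (op_add T (normal_cone P)).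
Proof.
move=> maxT T0 cY bc plP Pc; have mT := maxT.1.
have aP := plane_affine plP.
have Yc : aff (op_dom T) c := bc.1.
have aY : affine_set (aff (op_dom T)) := @aff_affine _ _ _.
pose V := direction (aff (op_dom T)).
have sV : linear_subspace V := direction_subspace aY.
have wV : weakly_closed V by apply: closed_weakly_closed => //; exact: direction_closed.
have [g Tcg] := bounded_point_dom mT maxT T0 bc.
move: plP => [p [u [v [_ PE]]]].
have Puv x (a b : R) : P x -> P (x + (a *: u + b *: v)).
  rewrite PE => -[a' [b' ->]]; exists (a' + a), (b' + b).
  by apply: dual_separates => f; rewrite !evE; ring.
have PB x y : P x -> P y -> exists a b : R, y - x = a *: u + b *: v.
  rewrite PE => -[a [b ->]] [a' [b' ->]]; exists (a' - a), (b' - b).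
  by apply: dual_separates => f; rewrite !evE; ring.
have NP x f : P x -> ev f u = 0 -> ev f v = 0 -> normal_cone P x f.
  move=> Px fu fv; split=> // y Py; have [a [b ->]] := PB _ _ Px Py.
  by rewrite -[f _]/(ev f _) !evE fu fv !mulr0 addr0.
apply/maximal_monotoneP; split.
  move=> x y _ _ [f1 Tf1 [g1 Ng1 <-]] [f2 Tf2 [g2 Ng2 <-]].
  have := mT _ _ _ _ Tf1 Tf2; have := normal_cone_monotone Ng1 Ng2.
  rewrite -![dual_fun _ _]/(ev _ _) !evE; lra.
move=> z f0 rel.
(* Otherwise some [h] vanishing on [W] has [h (z - c) = 1], and adding a large multiple of it to [g]
   at [c] violates relatedness; the multiple chosen makes the pairing [-1]. *)
have inW (W : set X) : weakly_closed W ->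
    (forall h, vanishes W h -> op_add T (normal_cone P) c (g + h)) -> W (z - c).
  move=> wW addW; apply: contrapT => /wW[h Wh hz].
  have := rel c (g + (ev (g - f0) (c - z) + 1) *: h).
  have -> : ev (g + (ev (g - f0) (c - z) + 1) *: h - f0) (c - z) =
    ev (g - f0) (c - z) - (ev (g - f0) (c - z) + 1) * ev h (z - c).
    by rewrite !evE; ring.
  rewrite hz => relz; suff : op_add T (normal_cone P) c
    (g + (ev (g - f0) (c - z) + 1) *: h) by move=> /relz; lra.
  by apply: addW => w Ww; rewrite evZl Wh// mulr0.
have Pz : P z.
  have [|a [b zE]] := inW _ (@span2_weakly_closed u v).
    move=> h Wh; exists g => //; exists h => //; apply: NP => //; apply: Wh.
      by exists 1, 0; rewrite scale1r scale0r addr0.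
    by exists 0, 1; rewrite scale1r scale0r add0r.
  by rewrite -[z](subrK c) addrC zE; exact: Puv.
have Yz : aff (op_dom T) z.
  rewrite -[z](subrK c) addrC; apply: (inW V wV) => // h Vh.
  exists (g + h); first exact: maximal_add_vanishing.
  by exists 0; [apply: NP; rewrite ?ev0l|rewrite addr0].
have [x f Px Tf|f Tf fP] := @selection_on_affine_set _ _ T maxT T0 P c z f0 aP bc Pc Pz Yz.
  by apply: rel; exists f => //; exists 0; [apply: NP; rewrite ?ev0l|rewrite addr0].
(* [f] agrees with [f0] on directions common to [P] and [V]. Hence [f0 - f] is the sum of [h], which
   [T z] absorbs, and a functional vanishing along [P], which lies in the normal cone. *)
have [a b Vab|h Vh [hu hv]] := @vanishing_extension _ _ V (f0 - f) u v sV wV.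
  have := fP (z + (a *: u + b *: v)) (Puv _ _ _ Pz) (Vab _ Yz).
  by rewrite [z + _]addrC addrK evBl => ->; rewrite subrr.
exists (f + h); first exact: maximal_add_vanishing.
exists (f0 - (f + h)); last by rewrite addrC subrK.
by apply: NP => //; move: hu hv; rewrite !evE; lra.
Qed.

End Planes.

(** * Weak-star closed convex sets *)

Section WeakStar.
Context {R : realType} {X : normedModType R}.
Implicit Types (f g h : dual X) (u : X) (A : set (dual X)).

Lemma ev_weak_star_continuous u : continuous (ev^~ u : weak_star X -> R).
Proof.
move=> f.
have h1 : {for f, continuous (@dual_fun R X : weak_star X -> {ptws X -> R^o})}.
  exact: initial_continuous.
have h2 := @proj_continuous X (fun=> R^o) u (dual_fun f).
exact: (continuous_comp h1 h2).
Qed.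

Lemma weak_star_cvg (F : set_system (dual X)) f : Filter F ->
  (forall u, (ev g u @[g --> F]) --> ev f u) -> F --> (f : weak_star X).
Proof.
move=> FF Ff.
have : {ptws, (@dual_fun R X) @ F --> (f : X -> R^o)}.
  by apply/pointwise_cvgP => u; exact: Ff.
move=> cvF A [_ [[W oW <-] Wf WA]]; apply: filterS WA _.
by apply: cvF; exact: open_nbhs_nbhs.
Qed.

(** Otherwise the elements of [A] close to [f0] at finitely many points form a filter base
    converging to [f0]. *)
Lemma weak_star_closed_separated A f0 :
  closed (A : set (weak_star X)) -> ~ A f0 ->
  exists (s : seq X) (e : R), 0 < e /\
    forall g, A g -> exists2 u, u \in s & e <= `|ev g u - ev f0 u|.
Proof.
move=> cA nA; apply: contrapT => nsep; apply: nA.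
pose U (i : seq X * R) := [set g | A g /\
  forall u, u \in i.1 -> `|ev g u - ev f0 u| < i.2].
pose F := filter_from [set i : seq X * R | 0 < i.2] U.
have FF : ProperFilter F.
  apply: filter_from_proper.
    apply: filter_from_filter; first by exists ([::], 1) => /=.
    move=> [s e] [s' e'] /= e0 e'0; exists (s ++ s', Num.min e e').
      by rewrite /= lt_min e0.
    move=> g [Ag gs] /=; split; split=> // u us.
      by have := gs u; rewrite mem_cat us => /(_ isT); rewrite lt_min => /andP[].
    by have := gs u; rewrite mem_cat us orbT => /(_ isT); rewrite lt_min => /andP[].
  move=> [s e] /= e0; apply: contrapT => nU; apply: nsep.
  exists s, e; split=> // g Ag; apply: contrapT => nu; apply: nU.
  by exists g; split=> // u us; rewrite ltNge; apply/negP => le; apply: nu; exists u.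
have FA : F A by exists ([::], 1) => //= g [].
have cvF : F --> (f0 : weak_star X).
  apply: weak_star_cvg => u; apply/cvgrPdist_lt => e e0.
  exists ([:: u], e) => // g [_ /= gu]; rewrite distrC; apply: gu.
  by rewrite inE.
exact: (@closed_cvg _ (weak_star X) F _ id A cA FA f0 cvF).
Qed.

(** Finitely many coordinates [t i] keep [A] away from [f0]. Separation in that finite-dimensional
    space is evaluation at a combination [u] of the [t i], where some element of [A] agrees with
    [f0]. *)
Lemma weak_star_closed_convex_mem A f0 :
  closed (A : set (weak_star X)) ->
  convex_set (A : set (convex_lmodType (dual X))) ->
  (forall u, exists2 f, A f & ev f u = ev f0 u) -> A f0.
Proof.
move=> cA vA Au; apply: contrapT => /(weak_star_closed_separated cA)[s [e [e0 sepA]]].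
pose n := size s; pose t (i : 'I_n) := nth 0 s i.
pose L (g : dual X) : 'rV[R]_n := \row_i (ev g (t i) - ev f0 (t i)).
pose p (x : 'rV[R]_n) : R := \sum_i `|x 0 i|.
have sp : sublinear p.
  split=> [x y|k x k0].
    by rewrite /p -big_split; apply: ler_sum => i _; rewrite mxE ler_normD.
  by rewrite /p mulr_sumr; apply: ler_sum => i _; rewrite mxE normrM ger0_norm.
have [|k x b x' b' /andP[k0 k1] [g Ag [-> ->]]
    [g' Ag' [-> ->]]|x b [g Ag [-> ->]]|h [hlin _ hL]] :=
  @mazur_orlicz R 'rV[R]_n p (fun x b => exists2 g, A g & x = L g /\ b = - e) sp.
- by have [g Ag _] := Au 0; exists (L g), (- e), g.
- exists ((1 - k) *: g + k *: g').
    (* The weight [k] of [conv] goes to its first argument, hence the swap. *)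
    rewrite addrC; have := vA g' g (Itv01 k0 k1); rewrite !inE; exact.
  split; last by ring.
  by apply/rowP => i; rewrite !mxE !evE; ring.
- have [u us ue] := sepA g Ag; rewrite subr_ge0; apply: le_trans ue _.
  have iu : (index u s < n)%N by rewrite index_mem.
  rewrite /p (bigD1 (Ordinal iu)) //= !mxE /t /= nth_index// normrN lerDl.
  exact: sumr_ge0.
have h0 : h 0 = 0 by have := hlin 1 0 0; rewrite scale1r addr0; lra.
have hD x y : h (x + y) = h x + h y by have := hlin 1 x y; rewrite scale1r mul1r.
have hZ k x : h (k *: x) = k * h x by have := hlin k x 0; rewrite h0 !addr0.
pose u := \sum_i h (delta_mx 0 i) *: t i.
have evu g : ev g u = \sum_i h (delta_mx 0 i) * ev g (t i).
  by rewrite (big_morph (ev g) (evD g) (ev0 g)); apply: eq_bigr => i _; rewrite evZ.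
have hLu g : h (L g) = ev g u - ev f0 u.
  rewrite [L g]row_sum_delta (big_morph h hD h0) !evu -sumrB.
  by apply: eq_bigr => i _; rewrite hZ mxE; ring.
have [g Ag gu] := Au u.
have := hL (L g) (- e); rewrite hLu gu subrr.
move=> /(_ (ex_intro2 _ _ g Ag (conj erefl erefl))).
lra.
Qed.

(** By maximality [T x] is an intersection of weak-star closed half-spaces, one for each point of
    the graph. *)
Lemma maximal_monotone_closed_convex (T : X -> set (dual X)) x :
  maximal_monotone T ->
  closed (T x : set (weak_star X)) /\
  convex_set (T x : set (convex_lmodType (dual X))).
Proof.
move=> /maximal_monotoneP[mT relT].
have TE f : T x f <-> forall y g, T y g -> ev f (y - x) <= ev g (y - x).
  split=> [Txf y g Tyg|h].
    have := mT _ _ _ _ Tyg Txf; rewrite -[(g - f) _]/(ev (g - f) _) evBl; lra.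
  by apply: relT => y g /h; rewrite evBl; lra.
split.
  have -> : T x = \bigcap_(z in [set z | T z.1 z.2])
      ((ev^~ (z.1 - x) : weak_star X -> R) @^-1` [set r | r <= ev z.2 (z.1 - x)]).
    apply/seteqP; split=> [f /TE h [y g] /= Tyg|f h]; first exact: h.
    by apply/TE => y g Tyg; exact: (h (y, g)).
  apply: closed_bigI => z _; apply: closed_comp; last exact: closed_le.
  by move=> f _; exact: ev_weak_star_continuous.
move=> f g k; rewrite !inE => /TE fT /TE gT; apply/TE => y h Tyh.
have := fT _ _ Tyh; have := gT _ _ Tyh => h1 h2.
have -> : ev (conv k f g) (y - x) = k%:inum * ev f (y - x) + (1 - k%:inum) * ev g (y - x).
  by [].
have k0 : 0 <= k%:inum by [].
have k1 : 0 <= 1 - k%:inum by rewrite subr_ge0.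
have := ler_wpM2l k0 h2; have := ler_wpM2l k1 h1; lra.
Qed.

End WeakStar.

(** * Planes through given points *)

Section PlaneExistence.
Context {R : realType} {X : normedModType R}.
Implicit Types (u v w e : X).

Lemma not_lin_indep2 u v : u != 0 -> ~ lin_indep2 u v ->
  exists k : R, v = k *: u.
Proof.
move=> u0 dep; apply: contrapT => nk; apply: dep => a b ab.
have b0 : b = 0.
  apply/eqP/negPn/negP => bN0; apply: nk; exists (- (b^-1 * a)).
  apply: (scalerI bN0); rewrite scaleNr scalerN scalerA mulVKf//.
  by apply/eqP; rewrite -addr_eq0 addrC ab.
split=> //; move: ab; rewrite b0 scale0r addr0 => /eqP.
by rewrite scaler_eq0 (negbTE u0) orbF => /eqP.
Qed.

Lemma lin_indep2_extend e : dim_gt1 X -> e != 0 -> exists v, lin_indep2 e v.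
Proof.
move=> [p [q pq]] e0; apply: contrapT => /forallNP nv.
have [k pE] := not_lin_indep2 e0 (nv p); have [l qE] := not_lin_indep2 e0 (nv q).
have [l0 _] : l = 0 /\ - k = 0.
  by apply: pq; rewrite pE qE !scalerA mulNr mulrC scaleNr subrr.
have [] : (0 : R) = 0 /\ (1 : R) = 0.
  by apply: pq; rewrite qE l0 !scale0r scaler0 addr0.
by move=> _ /eqP; rewrite oner_eq0.
Qed.

(** [v] and [w] may be dependent or zero; dimension greater than one supplies the missing
    directions. *)
Lemma plane_through (x : X) v w : dim_gt1 X -> exists P, [/\ plane P, P x &
  forall a b : R, P (x + (a *: v + b *: w))].
Proof.
move=> dX.
have [e [e' [ee' [a1 [b1 vE]] [a2 [b2 wE]]]]] : exists e e', [/\ lin_indep2 e e',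
    exists a b : R, v = a *: e + b *: e' & exists a b : R, w = a *: e + b *: e'].
  have single e : e != 0 -> (exists k : R, v = k *: e) -> (exists k : R, w = k *: e) ->
      exists e e', [/\ lin_indep2 e e',
        exists a b : R, v = a *: e + b *: e' & exists a b : R, w = a *: e + b *: e'].
    move=> /(lin_indep2_extend dX)[e' ee'] [k ->] [l ->]; exists e, e'; split=> //.
      by exists k, 0; rewrite scale0r addr0.
    by exists l, 0; rewrite scale0r addr0.
  have [vw|nvw] := pselect (lin_indep2 v w).
    exists v, w; split=> //; first by exists 1, 0; rewrite scale1r scale0r addr0.
    by exists 0, 1; rewrite scale1r scale0r add0r.
  have [v0|v0] := eqVneq v 0; last first.
    by apply: (single v) => //; [exists 1; rewrite scale1r|exact: not_lin_indep2].
  have [w0|w0] := eqVneq w 0; last first.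
    by apply: (single w) => //; [exists 0; rewrite scale0r|exists 1; rewrite scale1r].
  have [p [q pq]] := dX; exists p, q; split=> //; exists 0, 0;
    by rewrite ?v0 ?w0 !scale0r addr0.
exists [set y | exists a b : R, y = x + a *: e + b *: e']; split.
- by exists x, e, e'.
- by exists 0, 0; rewrite !scale0r !addr0.
- move=> a b; exists (a * a1 + b * a2), (a * b1 + b * b2).
  by apply: dual_separates => f; rewrite vE wE !evE; ring.
Qed.

End PlaneExistence.

Theorem theorem22 (R : realType) (X : completeNormedModType R)
    (T : X -> set (dual X)) :
  dim_gt1 X ->
  op_graph T !=set0 ->
  monotone_op T ->
  ~ (exists x, op_dom T = [set x]) ->
  ic (op_dom T) !=set0 ->
  maximal_monotone T <->
  ((forall P : set X, plane P -> P `&` ic (op_dom T) !=set0 ->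
      maximal_monotone (op_add T (normal_cone P))) /\
   (forall x, op_dom T x ->
      closed (T x : set (weak_star X)) /\
      convex_set (T x : set (convex_lmodType (dual X))))).
Proof.
move=> dX T0 mT _ [c icc]; split=> [maxT|[planes values]].
  split=> [P plP [x [Px icx]]|x _]; last exact: maximal_monotone_closed_convex.
  apply: (maximal_add_normal_cone maxT T0 _ (ic_bounded_point mT icx)) => //.
  exact: icx.1.
apply/maximal_monotoneP; split=> // z f0 rel.
have sel u : exists2 f, T z f & ev f u = ev f0 u.
  have [P [plP Pz Puv]] := plane_through z (c - z) u dX.
  have Pc : P c.
    by have := Puv 1 0; rewrite scale1r scale0r addr0 addrC subrK.
  have Pu (t : R) : P (z + t *: u).
    by have := Puv 0 t; rewrite scale0r add0r.
  have /maximal_monotoneP[_ maxP] := planes P plP (ex_intro _ c (conj Pc icc)).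
  (* As [z] is in [P], a normal cone term only increases the pairing, so [(z, f0)] stays related to
     the sum. *)
  have [|f Tf [g [_ Ng] fg]] := maxP z f0.
    move=> y _ [f Tf [g [Py Ng] <-]]; have := rel _ _ Tf; have := Ng z Pz.
    by rewrite -[g _]/(ev g _) !evE; lra.
  exists f => //; rewrite -fg evDl.
  (* Both [z + u] and [z - u] are in [P], so the normal vector [g] vanishes at [u]. *)
  have := Ng _ (Pu 1); have := Ng _ (Pu (-1)).
  rewrite -![g _]/(ev g _) ![z + _]addrC !addrK !evZ; lra.
have [f Tzf _] := sel 0; have [cz vz] := values z (ex_intro _ f Tzf).
exact: weak_star_closed_convex_mem sel.
Qed.
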